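(* Let $n\in\mathbb N\cup\{\infty\}$, let $k^i\ge 0$ ($1\le i\le n$) satisfy $\sum_i e^{-k^i}\le 1$, let $T\ge1$, let $s_1,\dots,s_T\in[0,1]^n$ be a fixed sequence of loss vectors, and let $\ell_{1:T}$ be the expected cumulative loss of the FPL (Follow the Perturbed Leader) algorithm run with learning rates $\eta_t>0$. (i) If $\eta_t=\eta=1/\sqrt L$ for all $t$, where $L>0$ satisfies $L\ge \ell_{1:T}$, then $$\ell_{1:T}\le s_{1:T}^i+\sqrt{L}\,(k^i+1)\qquad\text{for all } i.$$ (ii) If $\eta_t=\sqrt{K/L}$ for all $t$, where $L>0$ satisfies $L\ge\ell_{1:T}$ and $K>0$ satisfies $k^i\le K$ for all $i$, then $$\ell_{1:T}\le s_{1:T}^i+2\sqrt{LK}\qquad\text{for all } i.$$ (iii) Fix an index $i$ with $k^i>0$. If $\eta_t=\sqrt{k^i/L}$ for all $t$, where $L\ge\max\{s_{1:T}^i,k^i\}$, then $$\ell_{1:T}\le s_{1:T}^i+2\sqrt{Lk^i}+3k^i .$$ (In (i) and (ii), $\ell_{1:T}$ in the condition $L\ge\ell_{1:T}$ is the expected loss of FPL run with the stated learning rate.)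
   Context: Experts are indexed by $i$ with $1\le i\le n$ (all $i\in\mathbb N$ if $n=\infty$). $s_t^i\in[0,1]$ is the loss of expert $i$ at time $t$, $s_{1:t}^i=s_1^i+\dots+s_t^i$, $s_{<t}^i=s_1^i+\dots+s_{t-1}^i$ (so $s_{<1}^i=0$). The number $k^i$ is called the complexity of expert $i$. FPL: let $q=(q^i)_{1\le i\le n}$ have independent components, each exponentially distributed with rate 1 (density $e^{-x}$, $x\ge0$), drawn once at the beginning. At time $t$, FPL with learning rate $\eta_t$ selects the expert $$I_t=\arg\min_{i}\Big\{s_{<t}^i+\frac{k^i-q^i}{\eta_t}\Big\}$$ (the minimum is attained, uniquely, almost surely). Its expected loss at time $t$ is $\ell_t=E[s_t^{I_t}]$, and $\ell_{1:T}=\ell_1+\dots+\ell_T$. *)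

(* Defs.v *)
From mathcomp Require Import all_boot all_order all_algebra.
From mathcomp Require Import all_classical all_reals all_analysis.

Set Implicit Arguments.
Unset Strict Implicit.
Unset Printing Implicit Defensive.

Import Order.TTheory GRing.Theory Num.Theory.

Local Open Scope classical_set_scope.
Local Open Scope ring_scope.

(* n : option nat stands for an element of N u {oo}: Some m is the finite
   number m, None is oo. Experts are numbered from 0 instead of 1. *)
Definition is_expert (n : option nat) (i : nat) : bool :=
  if n is Some m then (i < m)%N else true.

Definition expert (n : option nat) : Type := {i : nat | is_expert n i}.

Section probability.
Context {d : measure_display} {Omega : measurableType d} {R : realType}.
Variables (P : probability Omega R) (I : choiceType) (q : I -> {RV P >-> R}).

Definition mutually_independent : Prop :=
  forall (J : seq I) (B : I -> set R), uniq J ->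
    (forall i, measurable (B i)) ->
    P [set w | forall i, i \in J -> B i (q i w)] =
      (\prod_(i <- J) P (q i @^-1` B i))%E.

Definition iid_exponential : Prop :=
  mutually_independent /\
  forall i (B : set R), measurable B ->
    distribution P (q i) B = exponential_prob 1 B.

End probability.

Arguments mutually_independent {d Omega R} P {I} q.
Arguments iid_exponential {d Omega R} P {I} q.

Section argmin.
Context {R : realType} {n : option nat}.
Variable x : expert n -> R.

Definition is_argmin (i : expert n) : Prop := forall j, x i <= x j.

(* Ties go to the smallest index. The value is None exactly when the minimum
   is not attained. *)
Definition argmin : option (expert n) :=
  xget None (Some @` [set i | is_argmin i /\
                              forall j, is_argmin j -> (val i <= val j)%N]).

End argmin.

Section fpl.
Context {R : realType} {n : option nat}.

(* The loss of expert i at time t is s t i. Times start at 1, s 0 is unused. *)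
Definition cumulative_loss (s : nat -> expert n -> R) (T : nat) (i : expert n)
  : R := \sum_(1 <= t < T.+1) s t i.

Definition past_loss (s : nat -> expert n -> R) (t : nat) (i : expert n) : R :=
  \sum_(1 <= r < t) s r i.

Definition fpl_expert (k : expert n -> R) (s : nat -> expert n -> R)
    (eta : nat -> R) (t : nat) (x : expert n -> R) : option (expert n) :=
  argmin (fun i => past_loss s t i + (k i - x i) / eta t).

Context {d : measure_display} {Omega : measurableType d}.
Variables (P : probability Omega R) (q : expert n -> {RV P >-> R}).
Variables (k : expert n -> R) (s : nat -> expert n -> R) (eta : nat -> R).

(* The value 0 used when no expert attains the minimum is immaterial: under the
   standing assumptions this is a null event. *)
Definition fpl_loss (t : nat) : \bar R :=
  'E_P[fun w => oapp (s t) 0%R (fpl_expert k s eta t (fun i => q i w))]%E.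

Definition fpl_cumulative_loss (T : nat) : \bar R :=
  (\sum_(1 <= t < T.+1) fpl_loss t)%E.

End fpl.

Arguments fpl_loss {R n d Omega} P q k s eta t.
Arguments fpl_cumulative_loss {R n d Omega} P q k s eta T.

(* Main.v *)
(** The infeasible player follows at time [t] the leader determined by the
    losses up to and including time [t]. By the be-the-leader argument its total
    loss is at most [S^i + (k^i - q^i) / eta + max_j (q^j - k^j) / eta], and in
    expectation the perturbations cancel: [E q^i = 1], while
    [P (max_j (q^j - k^j) > r) <= \sum_j e^(- r - k^j) <= e^(- r)] gives
    [E max_j (q^j - k^j) <= 1]. Conditionally on the other perturbations, expert
    [i] leads when [q^i] exceeds a threshold, which a single round moves by at
    most [eta]; memorylessness of the exponential law then bounds the loss of
    FPL in each round by [e^eta] times that of the infeasible player. Hence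
    [ell <= e^eta (S^i + k^i / eta)], where (i) and (ii) use [1 - eta <= e^-eta]
    and (iii) uses [e^eta <= 1 + eta + eta^2]. *)

Require Import Defs.
From HB Require Import structures.
From mathcomp Require Import all_boot all_order all_algebra.
From mathcomp Require Import all_classical all_reals all_analysis.
From mathcomp Require Import measurable_realfun ring lra.
Import Order.TTheory GRing.Theory Num.Theory.
Local Open Scope classical_set_scope.
Local Open Scope ring_scope.

(** * Elementary inequalities for the exponential and the square root *)

Section exponential_bounds.
Import numFieldNormedType.Exports.

(** The function [(1 + y + y^2) e^-y] has derivative [y (1 - y) e^-y], which is nonnegative on
    [[0, 1]], and takes the value 1 at 0. *)
Lemma expR_le_quadratic {R : realType} (x : R) :
  0 <= x <= 1 -> expR x <= 1 + x + x ^+ 2.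
Proof.
move=> /andP[]; rewrite le_eqVlt => /predU1P[<- _|x0 x1].
  by rewrite expR0 expr0n/= !addr0.
pose g : R -> R := fun y => (1 + y + y ^+ 2) * expR (- y).
have dg (y : R) : is_derive y 1 g (y * (1 - y) * expR (- y)).
  rewrite /g; apply: is_derive_eq.
  rewrite /GRing.scale/=; ring.
have cg : {within `[0, x], continuous g}.
  apply: derivable_within_continuous => y _; exact: ex_derive.
have [c] := MVT x0 (fun y _ => dg y) cg.
rewrite in_itv/= => /andP[c0 cx] gE.
have : 0 <= g x - g 0.
  rewrite gE subr0 !mulr_ge0 ?expR_ge0 ?subr_ge0 ?(ltW c0) ?(ltW x0)//.
  exact: le_trans (ltW cx) x1.
rewrite /g !addr0 expr0n/= addr0 mul1r oppr0 expR0 subr_ge0 expRN.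
by rewrite ler_pdivlMr ?expR_gt0// mul1r.
Qed.

(** Multiply by [e^-e] and use [1 - e <= e^-e]. The factor [expR e] becomes an additive term in [x]
    itself, to which an a priori bound on [x] applies. *)
Lemma le_expRM_self {R : realType} (e x B : R) :
  0 <= x -> x <= expR e * B -> x <= B + e * x.
Proof.
move=> x0 /(ler_wpM2l (expR_ge0 (- e))).
rewrite mulrA [_ * expR e]mulrC expRxMexpNx_1 mul1r => xB.
have := ler_wpM2r x0 (expR_ge1Dx (- e)); lra.
Qed.

End exponential_bounds.

(** With [h] the square root of [K / L], these identities make every quantity in the final bounds a
    polynomial in [h] and [L]. *)
Lemma sqrt_divE {R : realType} (K L : R) : 0 < K -> 0 < L ->
  [/\ 0 < Num.sqrt (K / L), K = Num.sqrt (K / L) ^+ 2 * L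
    & Num.sqrt (L * K) = Num.sqrt (K / L) * L].
Proof.
move=> K0 L0; have KL0 : 0 < K / L by rewrite divr_gt0.
have KE : K = Num.sqrt (K / L) ^+ 2 * L.
  by rewrite sqr_sqrtr ?ltW// divfK ?gt_eqF.
split; rewrite ?sqrtr_gt0//.
have -> : L * K = (Num.sqrt (K / L) * L) ^+ 2 by rewrite {1}KE; ring.
by rewrite sqrtr_sqr ger0_norm// mulr_ge0 ?sqrtr_ge0// ltW.
Qed.

(** * Tails and expectations under the exponential law *)

Section exponential_tail.
Import numFieldNormedType.Exports.
Context {R : realType}.

Lemma exponential_prob_itvcy (x : R) : 0 <= x ->
  exponential_prob 1 `[x, +oo[ = (expR (- x))%:E.
Proof.
move=> x0; rewrite /exponential_prob.
rewrite (@ge0_continuous_FTC2y _ _ (fun y => - expR (- 1 * y)) _ 0).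
- by rewrite sub0e EFinN oppeK mulN1r.
- by move=> y _; exact: exponential_pdf_ge0.
- have := @within_continuous_exponential_pdf R 1.
  apply: continuous_subspaceW => y /=.
  by rewrite !in_itv/= !andbT; exact: le_trans.
- rewrite -oppr0; apply: cvgN.
  under eq_fun do rewrite mulN1r.
  exact: cvgr_expR.
- by move=> y _; exact: ex_derive.
- apply/cvg_at_right_filter; apply: cvgN; apply: continuous_comp.
  + by apply: continuousM => //; exact: cst_continuous.
  + exact: continuous_expR.
- move=> y; rewrite in_itv/= andbT => xy.
  by apply: derive1_exponential_pdf; rewrite in_itv/= andbT (le_lt_trans x0).
Qed.

Lemma exponential_prob_itvoy (x : R) : 0 <= x ->
  exponential_prob 1 `]x, +oo[ = (expR (- x))%:E.
Proof.
move=> x0; rewrite -exponential_prob_itvcy// /exponential_prob.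
apply: integral_itv_obnd_cbnd; apply/measurable_EFinP.
apply: measurable_funTS; exact: measurable_exponential_pdf.
Qed.

Context {d : measure_display} {Omega : measurableType d}.
Context {P : probability Omega R}.
Variable X : {RV P >-> R}.
Hypothesis hX : forall B : set R, measurable B ->
  distribution P X B = exponential_prob 1 B.

Lemma exponential_tail (x : R) : 0 <= x ->
  P (X @^-1` `[x, +oo[) = (expR (- x))%:E.
Proof. by move=> x0; rewrite -exponential_prob_itvcy// -hX. Qed.

(** For negative [x] the right-hand side exceeds 1. *)
Lemma exponential_tail_le (x : R) :
  (P (X @^-1` `[x, +oo[) <= (expR (- x))%:E)%E.
Proof.
have [x0|x0] := leP 0 x; first by rewrite exponential_tail.
apply: le_trans (probability_le1 P _) _; first exact: measurable_sfunP.
by rewrite lee_fin -expR0 ler_expR oppr_ge0 ltW.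
Qed.

Lemma ae_exponential_ge0 : {ae P, forall w, 0 <= X w}.
Proof.
exists (~` (X @^-1` `[0, +oo[)); split.
- by apply: measurableC; exact: measurable_sfunP.
- rewrite probability_setC; last exact: measurable_sfunP.
  by rewrite exponential_tail// oppr0 expR0 subee.
- by move=> w /= h; apply: contra_not h; rewrite in_itv/= andbT.
Qed.

(** The expectation is the integral of the tail [P (Y > r)] over [r >= 0]. That tail is [e^-r], the
    exponential density itself, so the integral is a total mass. The positive part is taken because
    [X] is nonnegative only almost surely. *)
Lemma expectation_exponential_pos (Y : {RV P >-> R}) :
  (forall w, Y w = Num.max (X w) 0) -> ('E_P[Y] = 1)%E.
Proof.
move=> YX; rewrite ge0_expectation_ccdf; last first.
  by move=> w; rewrite YX le_max lexx orbT.
transitivity (exponential_prob (1 : R) `[0, +oo[); last first.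
  by rewrite exponential_prob_itvcy// oppr0 expR0.
apply: eq_integral => r; rewrite inE/= in_itv/= andbT => r0.
rewrite exponential_pdfE// mul1r mulN1r -exponential_prob_itvoy// -hX//.
rewrite /ccdf /distribution /pushforward; congr (P _).
apply/seteqP; split => w /=; rewrite !in_itv/= !andbT YX lt_max.
  by case/orP => //; rewrite ltNge r0.
by move=> ->.
Qed.

End exponential_tail.

Lemma expectation_le1 {R : realType} {d} {Omega : measurableType d}
    {P : probability Omega R} (Y : {RV P >-> R}) :
  (forall w, 0 <= Y w) ->
  (forall r, 0 <= r -> (P [set w | (r < Y w)%R] <= (expR (- r))%:E)%E) ->
  ('E_P[Y] <= 1)%E.
Proof.
move=> Y0 tail; rewrite ge0_expectation_ccdf//.
rewrite -[leRHS](_ : exponential_prob (1 : R) `[0, +oo[ = 1%E); last first.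
  by rewrite exponential_prob_itvcy// oppr0 expR0.
apply: ge0_le_integral => //.
- by apply: measurable_funTS; exact: ccdf_measurable.
- apply/measurable_EFinP; apply: measurable_funTS.
  exact: measurable_exponential_pdf.
- move=> r /=; rewrite in_itv/= andbT => r0.
  rewrite exponential_pdfE// mul1r mulN1r; apply: le_trans (tail r r0).
  rewrite /ccdf /distribution /pushforward le_eqVlt; apply/orP; left; apply/eqP.
  by congr (P _); apply/seteqP; split => w /=; rewrite in_itv/= andbT.
Qed.

Lemma measurable_ler {d} {Omega : measurableType d} {R : realType}
    (f g : Omega -> R) :
  measurable_fun setT f -> measurable_fun setT g ->
  measurable [set w | f w <= g w].
Proof.
move=> mf mg; rewrite -[X in measurable X]setTI.
by have := measurable_fun_ler mf mg measurableT (Y := [set true]); exact.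
Qed.

Lemma measurable_ltr {d} {Omega : measurableType d} {R : realType}
    (f g : Omega -> R) :
  measurable_fun setT f -> measurable_fun setT g ->
  measurable [set w | f w < g w].
Proof.
move=> mf mg; rewrite -[X in measurable X]setTI.
by have := measurable_fun_ltr mf mg measurableT (Y := [set true]); exact.
Qed.

(** * Independence of one perturbation from all the others *)

Section independence.
Context {R : realType} {d : measure_display} {Omega : measurableType d}.
Context {P : probability Omega R} {I : countType} {q : I -> {RV P >-> R}}.

Lemma countType_bigcap_measurable (F : I -> set Omega) :
  (forall i, measurable (F i)) -> measurable (\bigcap_i F i).
Proof.
move=> mF; rewrite -[X in measurable X]setCK setC_bigcap.
apply: measurableC; apply: countable_bigcupT_measurable => // i.
exact: measurableC.
Qed.

Lemma countType_forall_measurable (F : I -> set Omega) :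
  (forall i, measurable (F i)) -> measurable [set w | forall i, F i w].
Proof.
move=> mF; rewrite (_ : mkset _ = \bigcap_i F i); last first.
  by apply/seteqP; split => w /= h i => [_|]; exact: h.
exact: countType_bigcap_measurable.
Qed.

Lemma all_but_measurable (C : I -> set R) (i : I) :
  (forall j, measurable (C j)) ->
  measurable [set w | forall j, j != i -> C j (q j w)].
Proof.
move=> mC.
apply: (@countType_forall_measurable (fun j w => j != i -> C j (q j w))) => j.
have [->|ji] := eqVneq j i.
  by rewrite (_ : (fun _ => _) = setT)//; apply/seteqP; split => w.
rewrite (_ : (fun _ => _) = q j @^-1` C j); first exact: measurable_sfunP.
by apply/seteqP; split => w /=; [exact|move=> + _].
Qed.

(** Mutual independence concerns finite families. The condition on all other indices is a decreasing
    limit of conditions on finitely many, and continuity of [P] from above passes the product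
    formula to the limit. *)
Lemma mutually_independent_all_but (i : I) (B : set R) (C : I -> set R) :
  mutually_independent P q -> measurable B -> (forall j, measurable (C j)) ->
  (P ((q i @^-1` B) `&` [set w | forall j, j != i -> C j (q j w)]) =
   P (q i @^-1` B) * P [set w | forall j, j != i -> C j (q j w)])%E.
Proof.
move=> ind mB mC.
(* The indices other than [i] with code below [m]. *)
pose J m := undup [seq j <- pmap pickle_inv (iota 0 m) | j != i].
have memJ m j : (j \in J m) = (j != i) && (pickle j < m)%N.
  rewrite mem_undup mem_filter; congr andb.
  rewrite mem_pmap; apply/mapP/idP => [[k]|jm].
    rewrite mem_iota add0n/= => km h.
    by move: (@pickle_invK I k); rewrite -h/= => ->.
  by exists (pickle j); rewrite ?mem_iota ?add0n// pickleK_inv.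
pose A m := [set w | forall j, j \in J m -> C j (q j w)].
have mA m : measurable (A m).
  apply: (@countType_forall_measurable (fun j w => j \in J m -> C j (q j w))).
  move=> j; have [jm|jm] := boolP (j \in J m); last first.
    by rewrite (_ : (fun _ => _) = setT)//; apply/seteqP; split => w.
  rewrite (_ : (fun _ => _) = q j @^-1` C j); first exact: measurable_sfunP.
  by apply/seteqP; split => w /=; [exact|move=> + _].
have homA : {homo A : m p / (m <= p)%N >-> (p <= m)%O}.
  move=> m p mp; apply/subsetPset => w Apw j; rewrite memJ => /andP[ji jm].
  by apply: Apw; rewrite memJ ji (leq_trans jm).
have capA : \bigcap_m A m = [set w | forall j, j != i -> C j (q j w)].
  apply/seteqP; split => w /=; last first.
    by move=> h m _ j; rewrite memJ => /andP[ji _]; exact: h.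
  by move=> h j ji; apply: (h (pickle j).+1) => //; rewrite memJ ji/=.
have mqB : measurable (q i @^-1` B) by exact: measurable_sfunP.
have prodA m : P (q i @^-1` B `&` A m) = (P (q i @^-1` B) * P (A m))%E.
  have iJ : i \notin J m by rewrite memJ eqxx.
  have PA := ind (J m) C (undup_uniq _) mC.
  (* One family of sets carries [B] at [i] and [C] elsewhere, so the product over [i :: J m] splits
     off its head. *)
  have := ind (i :: J m) (fun j => if j == i then B else C j).
  rewrite /= iJ undup_uniq => /(_ isT) PB.
  have -> : q i @^-1` B `&` A m = [set w | forall j, j \in i :: J m ->
      (if j == i then B else C j) (q j w)].
    apply/seteqP; split => w /=.
      move=> [Bw Aw] j; rewrite inE; case: eqVneq => [->//|_ /=]; exact: Aw.
    move=> h; split; first by have := h i; rewrite inE eqxx; exact.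
    move=> j jm; have := h j; rewrite inE jm orbT => /(_ isT).
    by case: eqVneq => // ji; move: jm; rewrite ji (negbTE iJ).
  rewrite PB; last by move=> j; case: ifP.
  rewrite big_cons eqxx [P (A m)]PA; congr (_ * _)%E.
  rewrite big_seq [RHS]big_seq; apply: eq_bigr => j jm.
  by case: eqVneq => // ji; move: jm; rewrite ji (negbTE iJ).
have lim1 : (P \o (fun m => q i @^-1` B `&` A m)) @ \oo -->
    P (q i @^-1` B `&` [set w | forall j, j != i -> C j (q j w)]).
  rewrite -capA -bigcapIr; last by exists 0%N.
  apply: nonincreasing_cvg_mu.
  - by rewrite (le_lt_trans (probability_le1 _ _)) ?ltry//; exact: measurableI.
  - by move=> m; exact: measurableI.
  - by apply: bigcapT_measurable => m; exact: measurableI.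
  - by move=> m p /homA/subsetPset Amp; apply/subsetPset; exact: setIS.
apply/esym; apply: (cvg_unique _ _ lim1) => //.
rewrite (_ : _ \o _ = fun m => (P (q i @^-1` B) * P (A m))%E);
  last exact/funext.
apply: cvgeZl; first exact: fin_num_measure.
rewrite -capA; apply: nonincreasing_cvg_mu => //.
- by rewrite (le_lt_trans (probability_le1 _ _)) ?ltry.
- exact: bigcapT_measurable.
Qed.

End independence.

(** * Memorylessness: the price of raising the threshold of a leader *)

Section perturbation.
Context {R : realType} {d : measure_display} {Omega : measurableType d}.
Context {P : probability Omega R} {I : countType} {q : I -> {RV P >-> R}}.
Hypothesis hq : iid_exponential P q.

(** The weak inequality is necessary for selection; the strict one in [beats] is sufficient,
    whatever the tie-breaking. *)
Let leads i (c : I -> R) := [set w | forall j, j != i -> q j w + c j <= q i w].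
Let beats i (c : I -> R) (h : R) :=
  [set w | forall j, j != i -> q j w + c j + h < q i w].

Lemma leads_measurable i c : measurable (leads i c).
Proof.
apply: (@countType_forall_measurable _ _ I
  (fun j w => j != i -> q j w + c j <= q i w)) => j.
have [ji|ji] := boolP (j != i); last first.
  by rewrite (_ : (fun _ => _) = setT)//; apply/seteqP; split => w.
rewrite (_ : (fun _ => _) = [set w | q j w + c j <= q i w]); last first.
  by apply/seteqP; split => w /=; [exact|move=> + _].
apply: measurable_ler => //; exact: measurable_funD.
Qed.

Lemma beats_measurable i c h : measurable (beats i c h).
Proof.
apply: (@countType_forall_measurable _ _ I
  (fun j w => j != i -> q j w + c j + h < q i w)) => j.
have [ji|ji] := boolP (j != i); last first.
  by rewrite (_ : (fun _ => _) = setT)//; apply/seteqP; split => w.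
rewrite (_ : (fun _ => _) = [set w | q j w + c j + h < q i w]); last first.
  by apply/seteqP; split => w /=; [exact|move=> + _].
apply: measurable_ltr => //.
by apply: measurable_funD => //; exact: measurable_funD.
Qed.

(* [leads i c] says that [q i] is at least [W := sup_(j != i) (q j + c j)],
   which is independent of [q i]. Slicing along [W] in (m e, (m + 1) e] replaces
   [W] by a constant on each slice; rounding costs [e], and another [e] makes
   the inequality strict. *)
Lemma leads_beats_grid i c h e : 0 <= h -> 0 < e ->
  (P (leads i c) <= (expR (h + e *+ 2))%:E * P (beats i c h))%E.
Proof.
move=> h0 e0.
pose A m := [set w | forall j, j != i -> q j w + c j <= m%:R * e].
(* [D 0] is the event [W <= 0], and [D m.+1] is the slice of [W] in [(m e, (m + 1) e]]. *)
pose D := seqD A.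
pose up (x : R) := q i @^-1` `[x, +oo[.
have mup x : measurable (up x) by exact: measurable_sfunP.
have mA m : measurable (A m).
  have := @all_but_measurable _ _ _ _ _ q
    (fun j => [set` `]-oo, m%:R * e - c j]]) i.
  rewrite (_ : mkset _ = A m); first by apply.
  by apply/seteqP; split => w /= Aw j ji; have := Aw j ji;
    rewrite in_itv/= lerBrDr.
have PA m x : P (up x `&` A m) = (P (up x) * P (A m))%E.
  have := @mutually_independent_all_but _ _ _ _ _ q i [set` `[x, +oo[]
    (fun j => [set` `]-oo, m%:R * e - c j]]) hq.1.
  rewrite (_ : mkset _ = A m); first by apply.
  by apply/seteqP; split => w /= Aw j ji; have := Aw j ji;
    rewrite in_itv/= lerBrDr.
have mD m : measurable (D m) by case: m => [|m]; [exact: mA|exact: measurableD].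
have subA m : A m `<=` A m.+1.
  by move=> w Aw j ji; rewrite (le_trans (Aw j ji))// ler_pM2r// ler_nat.
have PD m x : P (up x `&` D m) = (P (up x) * P (D m))%E.
  case: m => [|m]; first exact: PA.
  rewrite /D setIDA measureD//; last 2 first.
  - exact: measurableI.
  - by rewrite (le_lt_trans (probability_le1 _ _)) ?ltry//; exact: measurableI.
  have -> : up x `&` A m.+1 `&` A m = up x `&` A m.
    by rewrite -setIA (setIidr (@subA m)).
  rewrite [X in (X - _)%E](PA m.+1) [X in (_ - X)%E](PA m).
  rewrite -muleBr ?fin_num_measure//; last first.
    by apply: fin_num_adde_defr; exact: fin_num_measure.
  congr (_ * _)%E; rewrite measureD//.
    by rewrite setIidr.
  by rewrite (le_lt_trans (probability_le1 _ _)) ?ltry.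
have homA : {homo A : m p / (m <= p)%N >-> (m <= p)%O}.
  by apply/nondecreasing_seqP => m; apply/subsetPset.
have trivD : trivIset setT D by exact: trivIset_seqD.
have nonneg m : (0 <= (m%:R * e : R)) by rewrite mulr_ge0// ltW.
(* On [D m.+1] the leader has [q i >= m e]. On [D 0] only [q i >= 0] is available, almost surely;
   this explains [m.-1] and the intersection with [up 0]. *)
have upper : (P (leads i c) <=
    \sum_(m <oo) (expR (- (m.-1%:R * e)))%:E * P (D m))%E.
  pose F m := up (m.-1%:R * e) `&` D m.
  have mF m : measurable (F m) by rewrite /F; exact: measurableI.
  have mlu : measurable (leads i c `&` up 0).
    by apply: measurableI => //; exact: leads_measurable.
  have <- : P (leads i c `&` up 0) = P (leads i c).
    rewrite [RHS](measureDI P (leads_measurable i c) (mup 0)).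
    rewrite [X in (X + _)%E](_ : _ = 0%E) ?add0e//.
    apply: (@subset_measure0 _ _ _ _ _ (~` up 0)) => //.
    - by apply: measurableD => //; exact: leads_measurable.
    - exact: measurableC.
    - rewrite [LHS]probability_setC// exponential_tail// ?oppr0 ?expR0 ?subee//.
      exact: hq.2.
  apply: le_trans (measure_sigma_subadditive P mF _ _) _ => //.
    move=> w [lw]; rewrite /up/= in_itv/= andbT => uw.
    have [m _ Dm] : (\bigcup_m D m) w.
      rewrite eq_bigcup_seqD.
      exists (Num.trunc (q i w / e)).+1 => // j ji.
      rewrite (le_trans (lw j ji))// -ler_pdivrMr// ltW//.
      by rewrite truncnS_gt.
    exists m => //; split => //; rewrite /up/= in_itv/= andbT.
    case: m Dm => [|m] /=; first by rewrite mul0r.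
    move=> [_ /existsNP[j /not_implyP[ji /negP]]]; rewrite -ltNge => /ltW mj.
    by rewrite (le_trans mj)// lw.
  apply: lee_nneseries => m _ //; rewrite [leLHS]PD; apply: lee_pmul => //.
  by apply: exponential_tail_le; exact: hq.2.
(* On [D m] one has [W <= m e], so a threshold one grid step higher gives strict inequality. *)
have lower : (\sum_(m <oo) (expR (- (m.+1%:R * e + h)))%:E * P (D m) <=
    P (beats i c h))%E.
  pose G m := up (m.+1%:R * e + h) `&` D m.
  have mG m : measurable (G m) by rewrite /G; exact: measurableI.
  apply: le_trans (_ : (P (\bigcup_m G m) <= _)%E).
    rewrite measure_bigcup//; last exact: trivIset_setIl.
    rewrite [leRHS](@eq_eseriesl _ _ xpredT); last first.
      by move=> m /=; rewrite in_setT.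
    apply: lee_nneseries => m _; first by rewrite mule_ge0// lee_fin expR_ge0.
    rewrite [leRHS]PD exponential_tail//; first exact: hq.2.
    by rewrite addr_ge0.
  apply: le_measure; rewrite ?inE.
  - exact: bigcup_measurable.
  - exact: beats_measurable.
  - move=> w [m _ [uw Dw]] j ji; move: uw; rewrite /up/= in_itv/= andbT.
    apply: lt_le_trans; rewrite ltrD2r.
    have Aw : A m w by case: (m) Dw => // p [].
    by rewrite (le_lt_trans (Aw j ji))// ltr_pM2r// ltr_nat.
apply: le_trans upper _.
(* Slice by slice, the thresholds [m.-1 e] and [(m + 1) e + h] differ by at most [h + 2 e]. *)
apply: (@le_trans _ _ (\sum_(m <oo) (expR (h + e *+ 2))%:E *
    ((expR (- (m.+1%:R * e + h)))%:E * P (D m)))%E).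
  apply: lee_nneseries => m _; first by rewrite mule_ge0// lee_fin expR_ge0.
  rewrite muleA; apply: lee_pmul => //.
  rewrite -EFinM -expRD lee_fin ler_expR.
  rewrite [leRHS](_ : _ = - ((m%:R - 1) * e)); last by rewrite -natr1; ring.
  by rewrite lerN2 ler_pM2r//; case: m => [|m] /=; rewrite -?natr1; lra.
rewrite nneseriesZl; last by move=> m _; rewrite mule_ge0// lee_fin expR_ge0.
apply: lee_pmul => //; apply: nneseries_ge0 => m _ _.
by rewrite mule_ge0// lee_fin expR_ge0.
Qed.

(** Let the grid step tend to 0: for each [r] in [(0, 1)] the step [- ln r / 2] makes
    [r e^(h + 2 e)] equal to [e^h]. *)
Lemma leads_beats i c h : 0 <= h ->
  (P (leads i c) <= (expR h)%:E * P (beats i c h))%E.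
Proof.
move=> h0; apply/lee_mul01Pr => // r /andP[r0 r1].
have lnr : 0 < - ln r / 2 by rewrite divr_gt0// oppr_gt0 ln_lt0// r0.
apply: (@le_trans _ _ (r%:E * ((expR (h + (- ln r / 2) *+ 2))%:E *
    P (beats i c h)))%E).
  by rewrite lee_pmul2l// ?lte_fin//; exact: leads_beats_grid.
rewrite muleA -EFinM -{1}(lnK r0) -expRD.
by rewrite [X in expR X](_ : _ = h)//; rewrite mulr2n; lra.
Qed.

End perturbation.

(** * The selected expert as a measurable choice *)

Section argmin_theory.
Context {R : realType} {n : option nat}.
Implicit Types (x : expert n -> R) (i j : expert n).

(** Selection becomes a countable family of pairwise comparisons, strict against smaller indices,
    from which measurability follows. *)
Lemma argminP x i : argmin x = Some i <->
  forall j, x i <= x j /\ ((val j < val i)%N -> x i < x j).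
Proof.
rewrite /argmin; split=> [xi|h].
  have [] : (Some @` [set i | is_argmin x i /\
      forall j, is_argmin x j -> (val i <= val j)%N]) (Some i).
    by case: xgetP xi => [ox _ h <- | ].
  move=> i' [mini minv] [ii']; move: mini minv; rewrite {}ii' => mini minv j.
  split; first exact: mini.
  move=> ji; rewrite lt_neqAle mini andbT; apply/negP => /eqP xij.
  suff /minv : is_argmin x j by rewrite leqNgt ji.
  by move=> j'; rewrite -xij; exact: mini.
have mini : is_argmin x i by move=> j; have [] := h j.
have minv j : is_argmin x j -> (val i <= val j)%N.
  move=> minj; rewrite leqNgt; apply/negP => ji.
  by have [_ /(_ ji)] := h j; rewrite ltNge minj.
apply: xget_subset1; first by exists i.
move=> _ _ [a [mina va] <-] [b [minb vb] <-]; congr Some; apply: val_inj.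
by apply/eqP; rewrite eqn_leq va//= vb.
Qed.

Lemma argmin_min x i j : argmin x = Some i -> x i <= x j.
Proof. by move=> /argminP/(_ j)[]. Qed.

Lemma argmin_strict x i :
  (forall j, j != i -> x i < x j) -> argmin x = Some i.
Proof.
move=> h; apply/argminP => j; have [->|ji] := eqVneq j i.
  by rewrite ltnn.
by split => [|_]; [exact/ltW/h|exact: h].
Qed.

Lemma argmin_measurable {d} {Omega : measurableType d}
    (f : Omega -> expert n -> R) i :
  (forall j, measurable_fun setT (f ^~ j)) ->
  measurable [set w | argmin (f w) = Some i].
Proof.
move=> mf.
rewrite (_ : mkset _ = [set w | forall j,
  f w i <= f w j /\ ((val j < val i)%N -> f w i < f w j)]); last first.
  by apply/seteqP; split => w /= /argminP.
apply: (@countType_forall_measurable _ _ _ (fun j w =>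
  f w i <= f w j /\ ((val j < val i)%N -> f w i < f w j))) => j.
have [ji|ji] := boolP (val j < val i)%N.
  rewrite (_ : (fun _ => _) = [set w | f w i < f w j]).
    exact: measurable_ltr.
  apply/seteqP; split => w /=; first by case=> _; exact.
  by move=> h; split => //; exact: ltW.
rewrite (_ : (fun _ => _) = [set w | f w i <= f w j]).
  exact: measurable_ler.
by apply/seteqP; split => w /=; [case|].
Qed.

End argmin_theory.

(** * Expectations of functions of a countably valued choice *)

Section discrete_expectation.
Context {R : realType} {d : measure_display} {Omega : measurableType d}.
Context {P : probability Omega R} {E : countType}.
Implicit Types (N : Omega -> E) (h : E -> R).

Lemma measurable_fun_discrete N h :
  (forall e, measurable (N @^-1` [set e])) -> measurable_fun setT (h \o N).
Proof.
move=> mN _ Y _; rewrite setTI.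
rewrite (_ : _ @^-1` _ =
    \bigcup_e (if h e \in Y then N @^-1` [set e] else set0)); last first.
  apply/seteqP; split => w /=.
    by move=> Yw; exists (N w) => //=; rewrite ifT// inE.
  by move=> [e _]; case: ifPn => // eY /= ->; rewrite inE in eY.
by apply: countable_bigcupT_measurable => // e; case: ifP.
Qed.

(** The fibres of [N], indexed by codes, partition the space; codes of no element get the empty
    set. *)
Lemma expectation_discrete N h : (forall e, 0 <= h e) ->
  (forall e, measurable (N @^-1` [set e])) ->
  ('E_P[h \o N] = \sum_(m <oo)
    oapp (fun e => (h e)%:E * P (N @^-1` [set e])) 0 (pickle_inv m))%E.
Proof.
move=> h0 mN.
pose F m := if pickle_inv m is Some e then N @^-1` [set e] else set0.
have mF m : measurable (F m) by rewrite /F; case: pickle_inv.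
have UF : \bigcup_m F m = setT.
  apply/seteqP; split => // w _; exists (pickle (N w)) => //=.
  by rewrite /F pickleK_inv.
have tF : trivIset setT F.
  move=> m p _ _ [w []]; rewrite /F.
  have := @pickle_invK E m; have := @pickle_invK E p.
  by case: pickle_inv => // e /= <-; case: pickle_inv => // e' /= <- -> ->.
rewrite unlock -UF ge0_integral_bigcup//.
- apply: eq_eseriesr => m _; rewrite /F; case: pickle_inv => [e|]/=.
    rewrite -integral_cst//; apply: eq_integral => w; rewrite inE => we.
    by rewrite /= we.
  by rewrite integral_set0.
- rewrite UF; apply/measurable_EFinP; exact: measurable_fun_discrete.
- by move=> w _; rewrite lee_fin h0.
Qed.

(** Termwise comparison. Restricting it to [h e != 0] exempts the outcome [None], whose loss is
    0. *)
Lemma le_expectation_discrete N N' h (c : R) : 0 <= c -> (forall e, 0 <= h e) ->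
  (forall e, measurable (N @^-1` [set e])) ->
  (forall e, measurable (N' @^-1` [set e])) ->
  (forall e, h e != 0%R ->
    P (N @^-1` [set e]) <= c%:E * P (N' @^-1` [set e]))%E ->
  ('E_P[h \o N] <= c%:E * 'E_P[h \o N'])%E.
Proof.
move=> c0 h0 mN mN' NN'.
have hP0 N0 m : (0 <= oapp (fun e => (h e)%:E * P (N0 @^-1` [set e])) 0
    (@pickle_inv E m))%E.
  by case: pickle_inv => //= e; rewrite mule_ge0// lee_fin.
rewrite !expectation_discrete// -nneseriesZl//.
apply: lee_nneseries => // m _.
case: pickle_inv => [e|]/=; last by rewrite mule0.
have [->|he] := eqVneq (h e) 0; first by rewrite !mul0e mule0.
rewrite muleCA; apply: lee_pmul => //; first by rewrite lee_fin.
exact: NN'.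
Qed.

End discrete_expectation.

(** * The pathwise be-the-leader inequality *)

Section be_the_leader.
Context {R : realType} {n : option nat}.
Variables (k x : expert n -> R) (s : nat -> expert n -> R) (e m : R).

(** Induction on [T] for all [i] at once: the induction hypothesis is applied to the leader of the
    last round, whose perturbed total, that round included, is at most that of [i]. *)
Lemma be_the_leader T i : 0 < e -> (forall j, x j - k j <= m) ->
  (forall t j, (1 <= t <= T)%N -> 0 <= s t j) ->
  \sum_(1 <= t < T.+1) oapp (s t) 0 (fpl_expert k s (fun=> e) t.+1 x) <=
  cumulative_loss s T i + (k i - x i) / e + m / e.
Proof.
move=> e0 xm; elim: T i => [|T IH] i s0.
  rewrite /cumulative_loss !big_geq// add0r -mulrDl.
  by rewrite divr_ge0 ?(ltW e0)//; have := xm i; lra.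
have {}IH j : \sum_(1 <= t < T.+1) oapp (s t) 0
      (fpl_expert k s (fun=> e) t.+1 x) <=
    cumulative_loss s T j + (k j - x j) / e + m / e.
  by apply: IH => t l /andP[t1 tT]; apply: s0; rewrite t1 (leq_trans tT).
have sT j : cumulative_loss s T.+1 j = cumulative_loss s T j + s T.+1 j.
  by rewrite /cumulative_loss big_nat_recr.
rewrite big_nat_recr//=.
case E : (fpl_expert k s (fun=> e) T.+2 x) => [j|] /=.
  have := argmin_min _ _ i E; rewrite /= ![past_loss _ _ _]sT sT.
  by have := IH j; lra.
(* Without a leader the round costs 0, and the bound for [i] can only grow. *)
rewrite addr0 (le_trans (IH i))// !lerD2r sT lerDl.
by apply: s0; rewrite ltnS leqnn.
Qed.

End be_the_leader.

(** * The largest shifted perturbation *)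

Section shifted_maximum.
Context {R : realType} {d : measure_display} {Omega : measurableType d}.
Context {P : probability Omega R} {I : countType} {q : I -> {RV P >-> R}}.
Variable k : I -> R.
Hypothesis hq : forall i (B : set R), measurable B ->
  distribution P (q i) B = exponential_prob 1 B.
Hypothesis hk1 : (\esum_(i in [set: I]) (expR (- k i))%:E <= 1)%E.

Lemma shifted_union_bound (r : R) : 0 <= r ->
  (P (\bigcup_i [set w | (r < q i w - k i)%R]) <= (expR (- r))%:E)%E.
Proof.
move=> r0.
have mF i : measurable [set w | r < q i w - k i].
  by apply: measurable_ltr => //; exact: measurable_funB.
pose F m :=
  if @pickle_inv I m is Some i then [set w | r < q i w - k i] else set0.
pose a m := oapp (fun i => (expR (- k i))%:E) 0%E (@pickle_inv I m).
have a0 m : (0 <= a m)%E.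
  by rewrite /a; case: pickle_inv => //= i; rewrite lee_fin expR_ge0.
(* The sum over [I] is reindexed by codes as a series over the naturals, to match countable
   subadditivity. *)
have suma : (\sum_(m <oo) a m <= 1)%E.
  apply: le_trans hk1.
  rewrite nneseries_esumT//.
  rewrite (_ : \esum_(i in _) a i = \esum_(i in range (@pickle I)) a i)%E.
    rewrite (@reindex_esum _ _ _ setT _ (@pickle I)).
      by under eq_esum do rewrite /a pickleK_inv.
    split => [i _|i j _ _|m [i _ <-]]; first by exists i.
      exact: (pcan_inj pickleK_inv).
    by exists i.
  rewrite [RHS]esum_mkcond; apply: eq_esum => m _; case: ifPn => // mI.
  rewrite /a; have := @pickle_invK I m.
  case: pickle_inv => //= i im; exfalso.
  by move/negP: mI; apply; rewrite inE; exists i.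
apply: (@le_trans _ _ (\sum_(m <oo) (expR (- r))%:E * a m)%E); last first.
  rewrite nneseriesZl//.
  rewrite -[leRHS]mule1; apply: lee_pmul => //.
  exact: nneseries_ge0.
apply: le_trans (measure_sigma_subadditive P (F := F) _ _ _) _.
- by move=> m; rewrite /F; case: pickle_inv.
- exact: countable_bigcupT_measurable.
- by move=> w [i _ iw]; exists (pickle i) => //; rewrite /F pickleK_inv.
apply: lee_nneseries => // m _; rewrite /F /a.
case: pickle_inv => [i|]/=; last by rewrite measure0 mule0.
rewrite -EFinM -expRD -opprD.
apply: le_trans (exponential_tail_le _ (hq i) _).
apply: le_measure; rewrite ?inE//; first exact: measurable_sfunP.
by move=> w /= h; rewrite in_itv/= andbT; lra.
Qed.

(** [M] is the supremum [S] of the positive parts, made real by [fine]. It dominates wherever [S] is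
    finite; the union bound at arbitrarily large levels shows that [S] is infinite only on a null
    set, and it also bounds the tail of [M]. *)
Lemma shifted_maximum : exists M : {RV P >-> R}, [/\ forall w, 0 <= M w,
  {ae P, forall w, forall i, q i w - k i <= M w} & ('E_P[M] <= 1)%E].
Proof.
pose g m w :=
  oapp (fun i => (Num.max (q i w - k i) 0)%:E) 0%E (@pickle_inv I m).
have mg m : measurable_fun setT (g m).
  rewrite /g; case: pickle_inv => [i|]/=; last exact: measurable_cst.
  apply/measurable_EFinP; apply: measurable_maxr => //.
  exact: measurable_funB.
pose S w := esups (g ^~ w) 0.
have mS : measurable_fun setT S by exact: measurable_fun_esups.
have mfS : measurable_fun setT (fine \o S).
  exact: measurableT_comp.
pose M : {RV P >-> R} :=
  HB.pack (fine \o S) (isMeasurableFun.Build _ _ _ _ _ mfS).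
have gS m w : (g m w <= S w)%E by apply: ereal_sup_ubound; exists m.
have SU r w : 0 <= r -> (r%:E < S w)%E ->
    (\bigcup_i [set w | (r < q i w - k i)%R]) w.
  move=> r0 /ereal_sup_gt[_ [m _ <-]]; rewrite /g.
  case: pickle_inv => [i|]/=; rewrite lte_fin; last by rewrite ltNge r0.
  by rewrite lt_max => /orP[rw|]; [exists i|rewrite ltNge r0].
have S0 w : (0 <= S w)%E.
  apply: le_trans (gS 0%N w); rewrite /g; case: pickle_inv => //= i.
  by rewrite lee_fin le_max lexx orbT.
have mU r : measurable (\bigcup_i [set w | (r < q i w - k i)%R]).
  apply: countable_bigcupT_measurable => // i.
  by apply: measurable_ltr => //; exact: measurable_funB.
have mSy : measurable [set w | S w = +oo%E].
  by rewrite -[X in measurable X]setTI; exact: (mS measurableT [set +oo%E]).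
exists M; split.
- by move=> w; exact: fine_ge0.
- exists [set w | S w = +oo%E]; split.
  + exact: mSy.
  + apply/eqP; rewrite eq_le measure_ge0 andbT; apply/lee_addgt0Pr => e e0.
    (* A nonnegative level with [e^-r <= e]. *)
    rewrite add0e; pose r := Num.max 0 (- ln e).
    have r0 : 0 <= r by rewrite le_max lexx.
    apply: (@le_trans _ _ (expR (- r))%:E).
      apply: le_trans (shifted_union_bound _ r0).
      apply: le_measure; rewrite ?inE//.
      by move=> w /= Sw; apply: SU => //; rewrite Sw ltry.
    rewrite lee_fin -[leRHS](lnK e0) ler_expR lerNl.
    by rewrite le_max lexx orbT.
  + move=> w /= h; apply: contrapT => Sw; apply: h => i.
    rewrite -lee_fin fineK; last by rewrite ge0_fin_numE// ltey; apply/eqP.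
    apply: le_trans (gS (pickle i) w); rewrite /g pickleK_inv/= lee_fin.
    by rewrite le_max lexx.
- apply: expectation_le1 => [w|r r0]; first exact: fine_ge0.
  apply: le_trans (shifted_union_bound _ r0).
  apply: le_measure; rewrite ?inE//.
    exact: measurable_ltr.
  (* Where [S] is infinite, [fine] returns 0, which cannot exceed [r]. *)
  move=> w /= rM; apply: SU => //; move: rM (S0 w).
  by case: (S w) => //= rM _; rewrite ltNge r0 in rM.
Qed.

End shifted_maximum.

(** * Linearity of expectation for nonnegative functions *)

Section expectation_affine.
Context {R : realType} {d : measure_display} {Omega : measurableType d}.
Context {P : probability Omega R}.

Lemma ge0_expectation_affine (f g : Omega -> R) (a : R) :
  measurable_fun setT f -> measurable_fun setT g ->
  (forall w, 0 <= f w) -> (forall w, 0 <= g w) -> 0 <= a ->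
  ('E_P[fun w => (f w + g w * a)%R] = 'E_P[f] + a%:E * 'E_P[g])%E.
Proof.
move=> mf mg f0 g0 a0; rewrite unlock.
under eq_integral do rewrite EFinD mulrC EFinM.
rewrite ge0_integralD//=.
- rewrite ge0_integralZl//=; first exact/measurable_EFinP.
  by move=> w _; rewrite lee_fin.
- by move=> w _; rewrite lee_fin.
- exact/measurable_EFinP.
- by move=> w _; rewrite -EFinM lee_fin mulr_ge0.
- by apply/measurable_EFinP; exact: measurable_funM.
Qed.

Lemma ge0_expectation_sum {I : Type} (r : seq I) (f : I -> Omega -> R) :
  (forall i, measurable_fun setT (f i)) -> (forall i w, 0 <= f i w) ->
  ('E_P[fun w => (\sum_(i <- r) f i w)%R] = \sum_(i <- r) 'E_P[f i])%E.
Proof.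
move=> mf f0; rewrite unlock.
under eq_integral do rewrite -sumEFin.
rewrite ge0_integral_sum// => i; first exact/measurable_EFinP.
by move=> w _; rewrite lee_fin.
Qed.

End expectation_affine.

(** * Comparison of FPL with the infeasible player and with a fixed expert *)

Section fpl_bounds.
Context {R : realType} {d : measure_display} {Omega : measurableType d}.
Context {P : probability Omega R} {n : option nat}.
Context {q : expert n -> {RV P >-> R}}.
Variables (k : expert n -> R) (T : nat) (s : nat -> expert n -> R) (e : R).
Hypothesis hq : iid_exponential P q.
Hypothesis hk0 : forall i, 0 <= k i.
Hypothesis hk1 : (\esum_(i in [set: expert n]) (expR (- k i))%:E <= 1)%E.
Hypothesis hs : forall t i, (1 <= t <= T)%N -> 0 <= s t i <= 1.
Hypothesis e0 : 0 < e.

Definition leader t w := fpl_expert k s (fun=> e) t (fun i => q i w).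

(* The infeasible player follows at time [t] the leader of time [t.+1], which
   already accounts for the losses of time [t]. *)
Definition infeasible_loss t : \bar R :=
  ('E_P[oapp (s t) 0%R \o leader t.+1])%E.

Definition infeasible_cumulative_loss : \bar R :=
  (\sum_(1 <= t < T.+1) infeasible_loss t)%E.

Lemma leader_measurable t o : measurable (leader t @^-1` [set o]).
Proof.
have mSome i : measurable (leader t @^-1` [set Some i]).
  apply: argmin_measurable => j; apply: measurable_funD => //.
  by apply: measurable_funM => //; exact: measurable_funB.
case: o => [i|]; first exact: mSome.
rewrite (_ : _ @^-1` _ = ~` \bigcup_i (leader t @^-1` [set Some i])).
  apply: measurableC; apply: countable_bigcupT_measurable => //.
  exact: (@countableP (expert n)).
apply/seteqP; split => w /=; first by move=> N [j _ /=]; rewrite N.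
case E : (leader t w) => [j|//] h; exfalso; apply: h; by exists j.
Qed.

Lemma loss_ge0 t o : (1 <= t <= T)%N -> 0 <= oapp (s t) 0 o.
Proof. by case: o => [i|] //= /hs - /(_ i)/andP[]. Qed.

(** Selection of [i] at time [t] implies [leads i c], while [beats i c e] implies its selection at
    time [t.+1]; [leads_beats] links the two with factor [e^e]. *)
Lemma fpl_infeasible_loss t : (1 <= t <= T)%N ->
  (fpl_loss P q k s (fun=> e) t <= (expR e)%:E * infeasible_loss t)%E.
Proof.
move=> tT.
apply: (@le_expectation_discrete _ _ _ P _ (leader t) (leader t.+1)).
- exact: expR_ge0.
- by move=> o; exact: loss_ge0.
- exact: leader_measurable.
- exact: leader_measurable.
move=> [i _|/=]; last by rewrite eqxx.
(* Multiplied by [e], the comparison of the scores of [i] and [j] at time [t] reads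
   [q j + c j <= q i]. *)
pose c j := k i - k j + e * (past_loss s t i - past_loss s t j).
have pastS j : past_loss s t.+1 j = past_loss s t j + s t j.
  by rewrite /past_loss big_nat_recr//; case/andP: tT.
have := @leads_beats _ _ _ P _ q hq i c e (ltW e0).
set F := (X in (P X <= _ -> _)%E); set G := (X in (_ <= _ * P X -> _)%E) => FG.
have mF : measurable F by exact: leads_measurable.
have mG : measurable G by exact: beats_measurable.
have scale j w : e * (past_loss s t j + (k j - q j w) / e) =
    e * past_loss s t j + k j - q j w.
  by field; rewrite gt_eqF.
have scaleS j w : e * (past_loss s t.+1 j + (k j - q j w) / e) =
    e * past_loss s t j + e * s t j + k j - q j w.
  by rewrite pastS; field; rewrite gt_eqF.
apply: (@le_trans _ _ (P F)).
  apply: le_measure; rewrite ?inE//; first exact: leader_measurable.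
  move=> w /argmin_min ij j _; have := ij j.
  by rewrite -(ler_pM2l e0) !scale /c; lra.
apply: le_trans FG _; rewrite lee_pmul2l ?lte_fin ?expR_gt0//.
apply: le_measure; rewrite ?inE//; first exact: leader_measurable.
move=> w Gw; apply: argmin_strict => j ji; have Gj := Gw j ji.
rewrite -(ltr_pM2l e0) !scaleS; move: Gj; rewrite /c.
(* Round [t] raises the offset by [e (s t i - s t j)], which the margin [e] absorbs. *)
have /andP[_ si1] := hs _ i tT; have /andP[sj0 _] := hs _ j tT.
have := ler_wpM2l (ltW e0) si1; have := mulr_ge0 (ltW e0) sj0.
lra.
Qed.

Lemma infeasible_loss_ge0 t : (1 <= t <= T)%N -> (0 <= infeasible_loss t)%E.
Proof. by move=> tT; apply: expectation_ge0 => w; exact: loss_ge0. Qed.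

Lemma infeasible_cumulative_loss_le i :
  (infeasible_cumulative_loss <= (cumulative_loss s T i + k i / e)%:E)%E.
Proof.
have [M [M0 Mae EM]] := shifted_maximum k hq.2 hk1.
have mX : measurable_fun setT (fun w => Num.max (q i w) 0).
  by apply: measurable_maxr.
pose X : {RV P >-> R} := HB.pack (fun w => Num.max (q i w) 0)
  (isMeasurableFun.Build _ _ _ _ _ mX).
have EX : ('E_P[X] = 1)%E.
  by apply: (@expectation_exponential_pos _ _ _ _ (q i)) => //; exact: hq.2.
pose l t w := oapp (s t) 0 (leader t.+1 w).
pose Z w := \sum_(1 <= t < T.+1) l t w.
have ml t : measurable_fun setT (l t).
  by apply: measurable_fun_discrete => o; exact: leader_measurable.
have Z0 w : 0 <= Z w.
  by rewrite /Z big_nat_cond sumr_ge0// => t /andP[tT _]; exact: loss_ge0.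
have mZ : measurable_fun setT Z by exact: measurable_sum.
pose c := cumulative_loss s T i + k i / e.
have c0 : 0 <= c.
  rewrite addr_ge0 ?divr_ge0 ?(ltW e0)//.
  rewrite /cumulative_loss big_nat_cond sumr_ge0//.
  by move=> t /andP[/(hs _ i)/andP[]].
(* The perturbation of [i] is moved to the left so that both integrands are nonnegative; the
   pathwise inequality holds almost everywhere. *)
have step : ('E_P[fun w => (Z w + X w * e^-1)%R] <=
    'E_P[fun w => (cst c w + M w * e^-1)%R])%E.
  rewrite unlock; apply: ae_ge0_le_integral => //.
  - move=> w _; rewrite lee_fin addr_ge0// mulr_ge0// ?invr_ge0 ?(ltW e0)//.
    by rewrite le_max lexx orbT.
  - apply/measurable_EFinP; apply: measurable_funD => //.
    exact: measurable_funM.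
  - by move=> w _; rewrite lee_fin addr_ge0// mulr_ge0// invr_ge0 ltW.
  - apply/measurable_EFinP; apply: measurable_funD => //.
    exact: measurable_funM.
  - have := ae_exponential_ge0 _ (hq.2 i); move: Mae.
    apply: filterS2 => w Mw qw _; rewrite lee_fin.
    have := @be_the_leader _ _ k (fun j => q j w) s e (M w) T i e0 Mw.
    rewrite /X/= max_l// /c /Z /l /leader => h.
    have := h (fun t j tT => loss_ge0 t (Some j) tT).
    rewrite mulrBl; lra.
have EZ : ('E_P[Z] = infeasible_cumulative_loss)%E.
  rewrite /infeasible_cumulative_loss big_add1 big_mkord.
  rewrite -(@ge0_expectation_sum _ _ _ P _ _ (fun t : 'I_T => l t.+1))//.
    by congr ('E_P[_])%E; apply/funext => w; rewrite /Z big_add1 big_mkord.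
  by move=> t w; apply: loss_ge0; rewrite ltn_ord.
have ei0 : 0 <= e^-1 by rewrite invr_ge0 ltW.
have X0 w : 0 <= X w by rewrite /X/= le_max lexx orbT.
move: step; rewrite (@ge0_expectation_affine _ _ _ P Z X)//.
rewrite (@ge0_expectation_affine _ _ _ P (cst c) M)//.
rewrite EZ EX expectation_cst mule1 => step.
(* Since [X] has mean 1 and [M] mean at most 1, the finite term [1 / e] cancels. *)
rewrite -(@leeD2rE _ (e^-1)%:E)//; apply: (le_trans step).
by rewrite leeD2lE// -[leRHS]mule1 lee_pmul// ?lee_fin// expectation_ge0.
Qed.

Lemma fpl_cumulative_loss_le i :
  (fpl_cumulative_loss P q k s (fun=> e) T <=
   (expR e * (cumulative_loss s T i + k i / e))%:E)%E.
Proof.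
rewrite EFinM.
apply: (@le_trans _ _ ((expR e)%:E * infeasible_cumulative_loss)%E).
  rewrite /fpl_cumulative_loss /infeasible_cumulative_loss big_nat_cond.
  rewrite [X in (_ * X)%E]big_nat_cond ge0_sume_distrr; last first.
    by move=> t /andP[tT _]; exact: infeasible_loss_ge0.
  by apply: lee_sum => t /andP[tT _]; exact: fpl_infeasible_loss.
rewrite lee_pmul2l ?lte_fin ?expR_gt0//.
exact: infeasible_cumulative_loss_le.
Qed.

Lemma fpl_cumulative_loss_ge0 :
  (0 <= fpl_cumulative_loss P q k s (fun=> e) T)%E.
Proof.
rewrite /fpl_cumulative_loss big_nat_cond; apply: sume_ge0 => t /andP[tT _].
by apply: expectation_ge0 => w; exact: loss_ge0.
Qed.

End fpl_bounds.

(** * The three choices of learning rate *)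

Theorem theorem5 (R : realType) (d : measure_display) (Omega : measurableType d)
    (P : probability Omega R) (n : option nat) (q : expert n -> {RV P >-> R})
    (k : expert n -> R) (T : nat) (s : nat -> expert n -> R)
    (hq : iid_exponential P q)
    (hk0 : forall i, 0 <= k i)
    (hk1 : (\esum_(i in [set: expert n]) (expR (- k i))%:E <= 1)%E)
    (hT : (1 <= T)%N)
    (hs : forall t i, (1 <= t <= T)%N -> 0 <= s t i <= 1) :
  let ell (eta : R) := fpl_cumulative_loss P q k s (fun=> eta) T in
  let S := cumulative_loss s T in
  [/\ (forall L : R, 0 < L ->
         (ell (1 / Num.sqrt L)%R <= L%:E)%E ->
         forall i, (ell (1 / Num.sqrt L)%R
                    <= (S i + Num.sqrt L * (k i + 1))%:E)%E),
      (forall L K : R, 0 < L -> 0 < K -> (forall i, k i <= K) ->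
         (ell (Num.sqrt (K / L))%R <= L%:E)%E ->
         forall i, (ell (Num.sqrt (K / L))%R
                    <= (S i + 2 * Num.sqrt (L * K))%:E)%E)
    & (forall (i : expert n) (L : R), 0 < k i -> Num.max (S i) (k i) <= L ->
         (ell (Num.sqrt (k i / L))%R
          <= (S i + 2 * Num.sqrt (L * k i) + 3 * k i)%:E)%E)].
Proof.
move=> ell S.
(* The two-sided bound makes the expected loss finite, so the rest is real arithmetic. *)
have ellE e i : 0 < e -> exists x : R, [/\ ell e = x%:E, 0 <= x &
    x <= expR e * (S i + k i / e)].
  move=> e0.
  have := fpl_cumulative_loss_le k T s e hq hk0 hk1 hs e0 i.
  have := @fpl_cumulative_loss_ge0 _ _ _ P _ q k T s e hs.
  rewrite -/(ell e); case: (ell e) => //= x; rewrite !lee_fin => x0 xS.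
  by exists x.
have S0 i : 0 <= S i.
  rewrite /S /cumulative_loss big_nat_cond sumr_ge0// => t /andP[tT _].
  by have /andP[] := hs t i tT.
split.
- move=> L L0 + i.
  have r0 : 0 < Num.sqrt L by rewrite sqrtr_gt0.
  have rr : Num.sqrt L * Num.sqrt L = L by rewrite -expr2 sqr_sqrtr// ltW.
  have [|x [-> x0 /(le_expRM_self _ _ _ x0)]] := ellE (1 / Num.sqrt L) i.
    by rewrite divr_gt0.
  rewrite !lee_fin => xS xL; move: xS; rewrite !div1r invrK.
  (* The self-referential term is at most [sqrt L] because [x <= L]. *)
  have : (Num.sqrt L)^-1 * x <= Num.sqrt L.
    by rewrite ler_pdivrMl// rr.
  lra.
- move=> L K L0 K0 kK + i.
  have [h0 KE ->] := sqrt_divE K L K0 L0.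
  set h := Num.sqrt (K / L) in h0 KE *.
  have [//|x [-> x0 /(le_expRM_self _ _ _ x0)]] := ellE h i.
  rewrite !lee_fin => xS xL.
  (* Both [k i / h] and [h x] are at most [h L], which gives the factor 2. *)
  have : k i / h <= h * L.
    by rewrite ler_pdivrMr// mulrAC -expr2 -KE.
  have := ler_wpM2l (ltW h0) xL.
  lra.
- move=> i L k0; rewrite ge_max => /andP[SL kL].
  have L0 : 0 < L by exact: lt_le_trans kL.
  have [h0 kE ->] := sqrt_divE (k i) L k0 L0.
  set h := Num.sqrt (k i / L) in h0 kE *.
  have h1 : h <= 1.
    by rewrite -[leRHS]sqrtr1 ler_wsqrtr// ler_pdivrMr// mul1r.
  have [//|x [-> x0 xS]] := ellE h i.
  rewrite lee_fin; have kh : k i / h = h * L.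
    by rewrite kE; field; rewrite gt_eqF.
  have : x <= (1 + h + h ^+ 2) * (S i + h * L).
    rewrite -kh (le_trans xS)// ler_wpM2r//.
      by rewrite addr_ge0// divr_ge0// ltW.
    by rewrite expR_le_quadratic// ltW.
  have h2 : 0 <= h ^+ 2 by exact: sqr_ge0.
  (* In the expanded product, [h L] and [h S] give [2 h L], while [h^2 L], [h^2 S] and [h^3 L] are
     each at most [h^2 L = k i], which gives [3 k i]. *)
  have := ler_wpM2l (ltW h0) SL; have := ler_wpM2l h2 SL.
  have := ler_wpM2l (mulr_ge0 h2 (ltW L0)) h1.
  rewrite [X in _ + 3 * X]kE; lra.
Qed.
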